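(* Let $p,q,r\in[0,1]$ with $p+q+r=1$, $0<p<1$ and $0<r<1$, and let $(m_n)_{n\ge1}$ be integers with $1\le m_n\le n$, $m_n\to\infty$ and $m_n/n\to0$ as $n\to\infty$. Write $m=m_n$, and let $N_n^*=\sum_{k=1}^n \mathbf 1_{\{X_k\neq0\}}$ be the number of non-zero steps among the first $n$ steps of the delayed elephant random walk with parameters $(p,q,r)$ and memory restricted to the first $m_n$ steps. Then $$\frac{N_n^*\,m^r}{n}\xrightarrow{d}\frac{Y}{\Gamma(1-r)}\quad\text{as } n\to\infty,$$ where $Y$ is the almost sure limit of $\Gamma(2-r)\,\widetilde N_j^*/j^{1-r}$ as $j\to\infty$, and $\widetilde N_j^*$ is the number of non-zero steps among the first $j$ steps of the full-memory delayed elephant random walk with the same parameters.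
   Context: Full-memory delayed elephant random walk with parameters $(p,q,r)$: $\widetilde X_1$ equals $1,-1,0$ with probabilities $p,q,r$ respectively. Given $\widetilde X_1,\dots,\widetilde X_k$, one sets $\widetilde X_{k+1}=+\widetilde X_K$ with probability $p$, $\widetilde X_{k+1}=-\widetilde X_K$ with probability $q$, and $\widetilde X_{k+1}=0$ with probability $r$, where $K$ is uniform on $\{1,\dots,k\}$, and the choice of $K$ and of the case are independent of each other and of the past. Put $\widetilde N^*_j=\sum_{k=1}^j\mathbf 1_{\{\widetilde X_k\ne0\}}$. It is known that $\Gamma(2-r)\widetilde N_j^*/j^{1-r}$ converges almost surely to a random variable denoted $Y$. Delayed ERW with memory restricted to the first $m_n$ steps (triangular scheme): for each $n$, with $m=m_n$, the steps $X_1,\dots,X_n$ (depending on $n$, the index being suppressed) are defined as follows. $X_1,\dots,X_m$ are the first $m$ steps of a full-memory delayed ERW. For $m\le k<n$, given $X_1,\dots,X_k$, $X_{k+1}$ equals $X_K$, $-X_K$, $0$ with probabilities $p,q,r$, where $K$ is uniform on $\{1,\dots,m\}$, and $K$ and the case are independent of each other and of the past. *)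

(* Defs.v *)
From HB Require Import structures.
From mathcomp Require Import all_boot all_order all_algebra.
From mathcomp Require Import all_classical all_reals all_analysis.

Set Implicit Arguments.
Unset Strict Implicit.
Unset Printing Implicit Defensive.

Import Order.TTheory GRing.Theory Num.Theory.
Import numFieldNormedType.Exports.

Local Open Scope classical_set_scope.
Local Open Scope ring_scope.

(* Euler's Gamma function, meaningful for 0 < s *)
Definition Gamma (R : realType) (s : R) : R :=
  \int[lebesgue_measure]_(t in `]0, +oo[) (t `^ (s - 1) * expR (- t)).

(* The three set systems are meant to be sigma-algebras: each contains the
   whole space, so the product rule for pairs is a special case. *)
Definition independent3 (d : measure_display) (T : measurableType d)
    (R : realType) (P : probability T R) (F G H : set_system T) : Prop :=
  forall A B C : set T, F A -> G B -> H C ->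
    P (A `&` B `&` C) = (P A * P B * P C)%E.

Definition sigma_of (d d' : measure_display) (T : measurableType d)
    (T' : measurableType d') (X : T -> T') : set_system T :=
  preimage_set_system setT X measurable.

Definition past (d : measure_display) (T : measurableType d) (R : realType)
    (X : nat -> T -> R) (k : nat) : set_system T :=
  <<s \bigcup_(i in [set i | (1 <= i <= k)%N]) sigma_of (X i) >>.

Definition step_law (d : measure_display) (T : measurableType d)
    (R : realType) (P : probability T R) (p q r : R) (E : T -> R) : Prop :=
  [/\ P [set w | E w = 1] = p%:E,
      P [set w | E w = - 1] = q%:E
    & P [set w | E w = 0] = r%:E].

Definition uniform_upto (d : measure_display) (T : measurableType d)
    (R : realType) (P : probability T R) (l : nat) (K : T -> nat) : Prop :=
  forall i : nat, (1 <= i <= l)%N -> P [set w | K w = i] = (l%:R^-1)%:E.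

(* Steps are numbered from 1; X 0 plays no role.  Step k.+1 is made from the
   first k steps by recalling a uniform index K in {1, ..., l}; the case
   (+ X_K, - X_K or 0) is encoded by the factor E = 1, -1 or 0. *)
Definition delayed_step (d : measure_display) (T : measurableType d)
    (R : realType) (P : probability T R) (p q r : R)
    (X : nat -> {RV P >-> R}) (k l : nat) : Prop :=
  exists (K : {RV P >-> nat}) (E : {RV P >-> R}),
    [/\ uniform_upto P l K,
        step_law P p q r E,
        independent3 P (past X k) (sigma_of K) (sigma_of E)
      & {ae P, forall w, X k.+1 w = E w * X (K w) w}].

Definition full_memory_derw (d : measure_display) (T : measurableType d)
    (R : realType) (P : probability T R) (p q r : R)
    (X : nat -> {RV P >-> R}) : Prop :=
  step_law P p q r (X 1%N) /\
  forall k : nat, (1 <= k)%N -> delayed_step p q r X k k.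

(* Only X 1, ..., X n are constrained. *)
Definition restricted_memory_derw (d : measure_display) (T : measurableType d)
    (R : realType) (P : probability T R) (p q r : R) (m n : nat)
    (X : nat -> {RV P >-> R}) : Prop :=
  [/\ step_law P p q r (X 1%N),
      forall k : nat, (1 <= k < m)%N -> delayed_step p q r X k k
    & forall k : nat, (m <= k < n)%N -> delayed_step p q r X k m].

Definition nonzero_steps (T : Type) (R : realType) (X : nat -> T -> R)
    (n : nat) (w : T) : nat :=
  (\sum_(1 <= k < n.+1) (X k w != 0%R))%N.

(* The variables may live on different probability spaces. *)
Definition cvg_in_distribution (R : realType)
    (d : nat -> measure_display) (T : forall n, measurableType (d n))
    (P : forall n, probability (T n) R) (Z : forall n, T n -> R)
    (d' : measure_display) (T' : measurableType d') (P' : probability T' R)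
    (Z' : T' -> R) : Prop :=
  forall f : R -> R, continuous f -> (exists M : R, forall x, `|f x| <= M) ->
    ('E_(P n)[f \o Z n] @[n --> \oo] --> 'E_P'[f \o Z'])%E.

(* Main.v *)
Require Import Defs.
From HB Require Import structures.
From mathcomp Require Import all_boot all_order all_algebra.
From mathcomp Require Import all_classical all_reals all_analysis.
From mathcomp Require Import measurable_realfun ring lra.

Set Implicit Arguments.
Unset Strict Implicit.
Unset Printing Implicit Defensive.

Import Order.TTheory GRing.Theory Num.Theory.
Import numFieldNormedType.Exports.

Local Open Scope classical_set_scope.
Local Open Scope ring_scope.

(** The law of a walk enters only through the chain of counts. Let N_k be the
number of non-zero steps among the first k. A step that recalls one of the
first l steps is non-zero exactly when the recalled step is non-zero and the
case is not 0; hence, given the past, it is non-zero with probability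
rho = (1 - r) N_l / l. This is [mean_nonzero_step]; [mean_step] turns it into a
one-step recursion for the expectation of any function of (N_l, N_{k+1}), and
everything else about the walks follows from that recursion.

With l = k (full memory) the recursion determines the law of every N_k
([full_memory_law_unique]), so N_m has the same law in the triangular scheme as
in the full-memory walk, and it yields E N_m <= 2 m^(1-r)
([mean_nonzero_steps_le]).

With l = m (restricted memory) the steps after time m are, given the first m
steps, Bernoulli trials with the frozen success probability rho. The deviation
S = N_n - N_m - (n - m) rho then satisfies E S^2 <= (n - m) E rho
([mean_deviation_sq]). Keeping the factor E rho, of order m^(-r), in this bound
is essential: the crude bound by n would only control m^r S / n when m^(2r) is
small compared with n.

Put W = (1 - r) N_m / m^(1-r) = m^r rho. Then

  m^r N_n / n = W + (m^r / n) S + (m^r / n) r N_m,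

where the second term has second moment at most 2 m / n, the third has mean at
most 2 m / n, and E W <= 2. For bounded continuous f these three bounds make
E f(m^r N_n / n) - E f(W) small ([restricted_memory_close]): a large W is
unlikely, f is uniformly continuous on compact intervals, and the other two
terms tend to 0 in probability.

Finally W may be computed in the full-memory walk, where the almost sure
convergence to Y and dominated convergence give
E f(W) --> E f((1 - r) Y / Gamma(2 - r)) as m --> oo ([full_memory_cvg]), and
Gamma(2 - r) = (1 - r) Gamma(1 - r) ([Gamma_rec]). *)

(** * Gamma function *)

Lemma FTC_on_pos (R : realType) (F f : R -> R) (a b : R) : 0 < a < b ->
  (forall x : R, 0 < x -> is_derive x 1 F (f x)) ->
  (forall x : R, 0 < x -> {for x, continuous f}) ->
  (\int[lebesgue_measure]_(x in `[a, b]) (f x)%:E = (F b - F a)%:E)%E.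
Proof.
move=> /andP[a0 ab] dF cf.
have cF x : 0 < x -> {for x, continuous F}.
  move=> x0; apply: differentiable_continuous; apply/derivable1_diffP.
  by have := dF _ x0; case.
rewrite EFinB; apply: continuous_FTC2 => //.
- apply: continuous_in_subspaceT => x; rewrite inE/= in_itv/= => /andP[ax _].
  exact/cf/(lt_le_trans a0).
- split.
  + by move=> x; rewrite in_itv/= => /andP[ax _]; case: (dF x (lt_trans a0 ax)).
  + exact/cvg_at_right_filter/cF.
  + exact/cvg_at_left_filter/cF/(lt_trans a0).
- move=> x; rewrite in_itv/= => /andP[ax _].
  rewrite derive1E; apply: derive_val; exact: dF (lt_trans a0 ax).
Qed.

Section gamma.
Context {R : realType}.
Local Notation mu := (@lebesgue_measure R).

(** Compact intervals exhausting the positive half-line. The index shift keeps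
    the two end points distinct. *)
Definition trunc_itv (n : nat) : set R := `[(n.+2%:R)^-1, n.+2%:R]%classic.

Lemma trunc_itv_bounds (n : nat) : 0 < (n.+2%:R : R)^-1 < n.+2%:R.
Proof.
rewrite invr_gt0 ltr0n/= -[ltLHS]div1r ltr_pdivrMr ?ltr0n//.
by rewrite -natrM ltr1n.
Qed.

Lemma measurable_trunc_itv (n : nat) :
  measurable (trunc_itv n : set (measurableTypeR R)).
Proof. exact: measurable_itv. Qed.

Lemma cvg_trunc_itv (f : R -> R) :
  (forall x, 0 < x -> 0 <= f x) -> (forall x, 0 < x -> {for x, continuous f}) ->
  (\int[mu]_(x in trunc_itv n) (f x)%:E @[n --> \oo] -->
   \int[mu]_(x in `]0%R, +oo[) (f x)%:E)%E.
Proof.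
move=> f0 cf.
have pos n x : trunc_itv n x -> 0 < x.
  rewrite /trunc_itv /= in_itv/= => /andP[+ _]; apply: lt_le_trans.
  by have /andP[] := trunc_itv_bounds n.
have -> : `]0%R, +oo[%classic = \bigcup_n trunc_itv n.
  apply/seteqP; split => [x|x [n _ /pos]]; rewrite /= in_itv/= ?andbT//.
  move=> x0; pose k := (Num.trunc x + Num.trunc x^-1)%N.
  exists k => //; rewrite /trunc_itv /= in_itv/=; apply/andP; split.
    rewrite -[leRHS]invrK lef_pV2 ?posrE ?ltr0n ?invr_gt0//.
    apply/ltW/(lt_le_trans (truncnS_gt _)).
    by rewrite ler_nat /k ltnS ltnW// ltnS leq_addl.
  apply/ltW/(lt_le_trans (truncnS_gt _)).
  by rewrite ler_nat /k ltnS ltnW// ltnS leq_addr.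
apply: ge0_nondecreasing_set_cvg_integral.
- move=> n k nk; rewrite subsetEset /trunc_itv; apply: subset_itv.
    by rewrite bnd_simp lef_pV2 ?posrE ?ltr0n// ler_nat.
  by rewrite bnd_simp ler_nat.
- by move=> n; exact: measurable_itv.
- move=> n; apply/measurable_EFinP; apply: subspace_continuous_measurable_fun.
    exact: measurable_itv.
  by apply: continuous_in_subspaceT => x; rewrite inE => /pos; exact: cf.
- by move=> n x /pos /f0; rewrite lee_fin.
Qed.

Lemma continuous_gamma_integrand (s x : R) : 0 < x ->
  {for x, continuous (fun t : R => t `^ s * expR (- t))}.
Proof.
move=> x0; apply: continuousM.
  apply: differentiable_continuous; apply/derivable1_diffP.
  by apply: derivable_powR; rewrite in_itv/= andbT.
by apply: continuous_comp; [exact: continuousN|exact: continuous_expR].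
Qed.


Lemma is_derive_expRN (x : R) :
  is_derive x 1 (fun t : R => expR (- t)) (- expR (- x)).
Proof.
have := @is_derive1_comp R expR -%R x _ _ (is_derive_expR (- x))
  (is_deriveNid x 1).
by rewrite mulrN1; exact.
Qed.

Lemma is_derive_gamma_primitive (s x : R) : 0 < x ->
  is_derive x 1 (fun t : R => t `^ s * expR (- t))
    (s * (x `^ (s - 1) * expR (- x)) - x `^ s * expR (- x)).
Proof.
move=> x0; have := is_deriveM (is_derive1_powR s x0) (is_derive_expRN x).
by move/is_derive_eq; apply; rewrite /GRing.scale/=; ring.
Qed.

(** The derivative dominates t `^ s * expR (- t) for 0 <= s <= 1, by
    [powR_le1D]; its integral over the half-line is thus an explicit bound. *)
Lemma is_derive_affine_expRN (x : R) :
  is_derive x 1 (fun t : R => - ((2 + t) * expR (- t))) ((1 + x) * expR (- x)).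
Proof.
have d2 : is_derive x 1 (fun t : R => 2 + t) 1.
  have := is_deriveD (is_derive_cst (2 : R) x 1) (is_derive_id x (1 : R)).
  by rewrite add0r.
have := is_deriveN (is_deriveM d2 (is_derive_expRN x)).
by move/is_derive_eq; apply; rewrite /GRing.scale/=; ring.
Qed.

Lemma powR_le1D (s x : R) : 0 <= s <= 1 -> 0 < x -> x `^ s <= 1 + x.
Proof.
move=> /andP[s0 s1] x0; have [x1|/ltW x1] := leP x 1.
  have : x `^ s <= 1 `^ s by apply: ge0_ler_powR; rewrite ?nnegrE// ltW.
  by rewrite powR1 => h; apply: (le_trans h); rewrite lerDl ltW.
by apply: (le_trans (ler1_powR x1 s1)); rewrite lerDr.
Qed.

(** Integrating the derivative of t `^ s * expR (- t) over [1/n, n] relates the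
    truncated integrals for s and s + 1 up to boundary terms that vanish as n
    grows. The truncated integrals for s + 1 are bounded, so both integrals
    converge; convergence has to be proved because a divergent integral would
    make [Gamma] equal to 0. *)
Lemma Gamma_rec (s : R) : 0 < s < 1 ->
  Gamma (s + 1) = s * Gamma s /\ 0 < Gamma s.
Proof.
move=> /andP[s0 s1].
pose g (u t : R) : R := t `^ u * expR (- t).
have g0 u t : 0 <= g u t by rewrite mulr_ge0 ?powR_ge0 ?expR_ge0.
have cg u x : 0 < x -> {for x, continuous (g u)}.
  exact: continuous_gamma_integrand.
pose A (u : R) (n : nat) : \bar R := (\int[mu]_(x in trunc_itv n) (g u x)%:E)%E.
have posn n x : trunc_itv n x -> 0 < x.
  rewrite /trunc_itv /= in_itv/= => /andP[+ _]; apply: lt_le_trans.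
  by have /andP[] := trunc_itv_bounds n.
pose c n := g s n.+2%:R - g s n.+2%:R^-1.
have iA u n : mu.-integrable (trunc_itv n) (EFin \o g u).
  apply: continuous_compact_integrable; first exact: segment_compact.
  by apply: continuous_in_subspaceT => x; rewrite inE => /posn; exact: cg.
have fA u n : A u n \is a fin_num.
  exact: (integrable_fin_num (measurable_trunc_itv n) (iA u n)).
have AB n : (s%:E * A (s - 1)%R n - A s n = (c n)%:E)%E.
  rewrite /A -(integralZl (measurable_trunc_itv n) (iA _ n)).
  have iB : mu.-integrable (trunc_itv n) (EFin \o (fun x => s * g (s - 1) x)).
    exact: (integrableZl (measurable_trunc_itv n) s (iA (s - 1) n)).
  have := integralB_EFin (measurable_trunc_itv n) iB (iA s n).
  rewrite /= => <-.
  rewrite -(FTC_on_pos (trunc_itv_bounds n) (is_derive_gamma_primitive s)).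
    by apply: eq_integral.
  move=> x x0; apply: continuousB; last exact: cg.
  by apply: continuousM; [exact: cst_continuous|exact: cg].
have bound n : (A s n <= 3%:E)%E.
  apply: (@le_trans _ _
      (\int[mu]_(x in trunc_itv n) ((1 + x) * expR (- x))%:E)%E).
    apply: ge0_le_integral => //.
    - exact: measurable_trunc_itv.
    - by move=> x _; rewrite lee_fin.
    - exact: (measurable_int _ (iA s n)).
    - apply/measurable_EFinP; apply: measurable_funM.
        by apply: measurable_funD.
      by apply: measurableT_comp => //; exact: measurableT_comp.
    - move=> x /posn x0; rewrite lee_fin /g ler_wpM2r ?expR_ge0//.
      by apply: powR_le1D => //; rewrite !ltW.
  rewrite (FTC_on_pos (trunc_itv_bounds n)
    (fun x _ => is_derive_affine_expRN x)).
    rewrite lee_fin.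
    have b0 : 0 < (n.+2%:R : R) by rewrite ltr0n.
    have b1 : (n.+2%:R : R)^-1 <= 1 by rewrite invf_le1// ler1n.
    have b2 : 0 < (n.+2%:R : R)^-1 by rewrite invr_gt0.
    move: b0 b1 b2; move: (n.+2%:R : R) => b b0 b1 b2.
    have e2 : expR (- b^-1) <= 1 by rewrite expR_le1 oppr_le0 ltW.
    have e3 : (2 + b^-1) * expR (- b^-1) <= 3 * 1.
      by apply: ler_pM => //; rewrite ?expR_ge0//; lra.
    have e4 : 0 <= (2 + b) * expR (- b) by rewrite mulr_ge0 ?expR_ge0//; lra.
    by lra.
  move=> x x0; apply: continuousM; last first.
    by apply: continuous_comp; [exact: continuousN|exact: continuous_expR].
  by apply: continuousD; [exact: cst_continuous|exact: id].
have inv0 : (n.+2%:R : R)^-1 @[n --> \oo] --> 0.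
  by have := @cvg_harmonic R; rewrite -cvg_shiftS.
have c0 : c n @[n --> \oo] --> 0.
  rewrite -(subr0 0); apply: cvgB.
    (* t `^ s <= t and 1 + t ^+ 2 / 2 <= expR t bound g s t by 2 / t. *)
    apply: (@squeeze_cvgr _ _ _ _ (cst 0) (fun n => 2 * n.+2%:R^-1)).
    - apply: nearW => n; rewrite g0/= /g.
      have b0 : 1 <= (n.+2%:R : R) by rewrite ler1n.
      have l1 := ler1_powR b0 (ltW s1).
      have := @expR_ge1Dxn R n.+2%:R 1 (ler0n _ _).
      rewrite [_`!%:R](_ : _ = 2)// => l2.
      have e0 := expR_gt0 (n.+2%:R : R).
      rewrite expRN ler_pdivrMr// mulrAC ler_pdivlMr; last lra.
      by nra.
    - exact: cvg_cst.
    - by rewrite -[X in _ --> X](mulr0 2); exact: cvgMl_tmp.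
  apply: (@squeeze_cvgr _ _ _ _ (cst 0) (fun n => (n.+2%:R : R)^-1 `^ s)).
  - apply: nearW => n.
    by rewrite g0/= /g ler_piMr ?powR_ge0// expR_le1 oppr_le0 invr_ge0.
  - exact: cvg_cst.
  - move/cvg_at_rightP: (powR_cvg0 s0); apply; split; [by []|exact: inv0].
have cvA u : (A u n @[n --> \oo] --> \int[mu]_(x in `]0%R, +oo[) (g u x)%:E)%E.
  by apply: cvg_trunc_itv => x x0; [exact: g0|exact: cg].
set G1 := (\int[mu]_(x in `]0%R, +oo[) (g (s - 1) x)%:E)%E.
set G2 := (\int[mu]_(x in `]0%R, +oo[) (g s x)%:E)%E.
have G1ge0 : (0 <= G1)%E by apply: integral_ge0 => x _; rewrite lee_fin.
have G2ge0 : (0 <= G2)%E by apply: integral_ge0 => x _; rewrite lee_fin.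
have G2fin : G2 \is a fin_num.
  rewrite ge0_fin_numE//; apply: (@le_lt_trans _ _ 3%:E); last exact: ltry.
  have <- : limn (A s) = G2 by apply/cvg_lim => //; exact: cvA.
  apply: lime_le; first by apply/cvg_ex; exists G2; exact: cvA.
  exact: nearW.
have GE : (s%:E * G1 = G2)%E.
  have l1 : (s%:E * A (s - 1)%R n @[n --> \oo] --> s%:E * G1)%E.
    by apply: cvgeZl => //; exact: cvA.
  have l2 : (s%:E * A (s - 1)%R n @[n --> \oo] --> G2 + 0%:E)%E.
    have -> : (fun n => s%:E * A (s - 1)%R n)%E = (fun n => A s n + (c n)%:E)%E.
      by apply/funext => n; rewrite -AB addeC subeK.
    apply: cvgeD; first by rewrite fin_num_adde_defl.
      exact: cvA.
    by apply: cvg_EFin; [exact: nearW|].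
  by rewrite (cvg_unique _ l1 l2)// adde0.
have G1fin : G1 \is a fin_num.
  rewrite ge0_fin_numE// ltNge leye_eq; apply/negP => /eqP G1y.
  by move: G2fin; rewrite -GE G1y gt0_muley ?lte_fin.
have sG : s * fine G1 = fine G2 by rewrite -GE fineM.
rewrite /Gamma /Rintegral addrK -/G1 -/G2; split => //.
suff : 0 < fine G2 by rewrite -sG pmulr_rgt0.
apply: fine_gt0; rewrite -ge0_fin_numE// G2fin andbT.
have -> : (0 = 0%:E :> \bar R)%E by [].
(* Positivity: the integrand is at least c1 on [1/2, 2]. *)
pose c1 := (2^-1 : R) `^ s * expR (- 2).
apply: (@lt_le_trans _ _ (\int[mu]_(x in trunc_itv 0) (cst c1%:E x))%E).
  rewrite integral_cst; last exact: measurable_trunc_itv.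
  rewrite mule_gt0//; first by rewrite lte_fin mulr_gt0 ?expR_gt0// powR_gt0.
  rewrite /trunc_itv /= lebesgue_measure_itv/= lte_fin.
  have h2 : (2^-1 : R) < 2 by lra.
  by rewrite h2 -EFinB lte_fin; lra.
apply: (@le_trans _ _ (A s 0%N)).
  apply: ge0_le_integral => //.
  - exact: measurable_trunc_itv.
  - by move=> x _; rewrite lee_fin mulr_ge0 ?powR_ge0 ?expR_ge0.
  - exact: (measurable_int _ (iA s _)).
  - move=> x; rewrite /trunc_itv /= in_itv/= => /andP[x1 x2]; rewrite lee_fin.
    rewrite ler_pM ?powR_ge0 ?expR_ge0//; last by rewrite ler_expR lerN2.
    have h : (0 : R) <= 2^-1 by rewrite invr_ge0.
    by rewrite ge0_ler_powR ?nnegrE// ?(ltW s0)// (le_trans h).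
apply: ge0_subset_integral.
- exact: measurable_trunc_itv.
- exact: measurable_itv.
- apply/measurable_EFinP; apply: subspace_continuous_measurable_fun.
    exact: measurable_itv.
  apply: continuous_in_subspaceT => x; rewrite inE /= in_itv/= andbT.
  exact: cg.
- by move=> x _; rewrite lee_fin.
- by move=> x /posn; rewrite /= in_itv/= andbT.
Qed.
End gamma.

(** * Expectation of bounded random variables *)

Section bounded_mean.
Context {d : measure_display} {T : measurableType d} {R : realType}.
Variable P : probability T R.
Implicit Types (f g : T -> R) (A B : set T).

Definition bounded_rv f :=
  measurable_fun setT f /\ exists M : R, forall w, `|f w| <= M.

Definition mean f : R := \int[P]_w f w.

Lemma bounded_rv_integrable f : bounded_rv f -> P.-integrable setT (EFin \o f).
Proof.
move=> [mf [M fM]].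
apply: (@le_integrable _ _ _ P setT measurableT _ (cst M%:E)).
- exact/measurable_EFinP.
- by move=> w _ /=; rewrite lee_fin (le_trans (fM w)) ?ler_norm.
- exact: finite_measure_integrable_cst.
Qed.

Lemma expectation_mean f : bounded_rv f -> ('E_P[f] = (mean f)%:E)%E.
Proof.
move=> bf; rewrite unlock /mean /Rintegral fineK//.
exact: (integrable_fin_num measurableT (bounded_rv_integrable bf)).
Qed.

Lemma bounded_rv_cst (c : R) : bounded_rv (fun=> c).
Proof. by split; [exact: measurable_cst|exists `|c|]. Qed.

Lemma bounded_rvD f g : bounded_rv f -> bounded_rv g ->
  bounded_rv (fun w => f w + g w).
Proof.
move=> [mf [M fM]] [mg [N gN]]; split; first exact: measurable_funD.
by exists (M + N) => w; rewrite (le_trans (ler_normD _ _))// lerD.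
Qed.

Lemma bounded_rvM f g : bounded_rv f -> bounded_rv g ->
  bounded_rv (fun w => f w * g w).
Proof.
move=> [mf [M fM]] [mg [N gN]]; split; first exact: measurable_funM.
by exists (M * N) => w; rewrite normrM ler_pM.
Qed.

Lemma bounded_rvZ (c : R) f : bounded_rv f -> bounded_rv (fun w => c * f w).
Proof. exact/bounded_rvM/bounded_rv_cst. Qed.

Lemma bounded_rvB f g : bounded_rv f -> bounded_rv g ->
  bounded_rv (fun w => f w - g w).
Proof.
move=> bf bg; have := bounded_rvD bf (bounded_rvZ (-1) bg).
by under eq_fun do rewrite mulN1r.
Qed.

Lemma bounded_rv_indic A : measurable A -> bounded_rv (\1_A : T -> R).
Proof.
move=> mA; split; first exact: measurable_indic.
by exists 1 => w; rewrite indicE ger0_norm// lern1 leq_b1.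
Qed.

Lemma bounded_rv_sum (I : Type) (s : seq I) (F : I -> T -> R) :
  (forall i, bounded_rv (F i)) -> bounded_rv (fun w => \sum_(i <- s) F i w).
Proof.
move=> bF; elim: s => [|i s IH].
  by under eq_fun do rewrite big_nil; exact: bounded_rv_cst.
by under eq_fun do rewrite big_cons; exact: bounded_rvD.
Qed.

Lemma meanD f g : bounded_rv f -> bounded_rv g ->
  mean (fun w => f w + g w) = mean f + mean g.
Proof.
by move=> bf bg; rewrite /mean RintegralD//; exact: bounded_rv_integrable.
Qed.

Lemma meanB f g : bounded_rv f -> bounded_rv g ->
  mean (fun w => f w - g w) = mean f - mean g.
Proof.
by move=> bf bg; rewrite /mean RintegralB//; exact: bounded_rv_integrable.
Qed.

Lemma meanZ (c : R) f : bounded_rv f -> mean (fun w => c * f w) = c * mean f.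
Proof.
by move=> bf; rewrite /mean RintegralZl//; exact: bounded_rv_integrable.
Qed.

Lemma mean_cst (c : R) : mean (fun=> c) = c.
Proof. by rewrite /mean Rintegral_cst//= probability_setT mulr1. Qed.

Lemma mean_indic A : measurable A -> mean \1_A = fine (P A).
Proof. by move=> mA; rewrite /mean /Rintegral integral_indic// setIT. Qed.

Lemma mean_sum (I : Type) (s : seq I) (F : I -> T -> R) :
  (forall i, bounded_rv (F i)) ->
  mean (fun w => \sum_(i <- s) F i w) = \sum_(i <- s) mean (F i).
Proof.
move=> bF; elim: s => [|i s IH].
  rewrite big_nil; under [X in mean X]eq_fun do rewrite big_nil.
  exact: mean_cst.
rewrite big_cons -IH -meanD//; last exact: bounded_rv_sum.
by congr mean; apply/funext => w; rewrite big_cons.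
Qed.

Lemma mean_le f g : bounded_rv f -> bounded_rv g -> (forall w, f w <= g w) ->
  mean f <= mean g.
Proof.
by move=> bf bg fg; apply: le_Rintegral => //; exact: bounded_rv_integrable.
Qed.

Lemma mean_ge0 f : bounded_rv f -> (forall w, 0 <= f w) -> 0 <= mean f.
Proof. by move=> bf f0; apply: Rintegral_ge0. Qed.

Lemma mean_ae_eq f g : bounded_rv f -> bounded_rv g ->
  {ae P, forall w, f w = g w} -> mean f = mean g.
Proof.
move=> [mf _] [mg _] fg; congr fine; apply: ae_eq_integral => //.
- exact/measurable_EFinP.
- exact/measurable_EFinP.
- by apply: filterS fg => w -> _.
Qed.

Lemma norm_mean_le f : bounded_rv f -> `|mean f| <= mean (fun w => `|f w|).
Proof.
by move=> bf; apply: le_normr_Rintegral => //; exact: bounded_rv_integrable.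
Qed.

End bounded_mean.

(** * Counting non-zero steps *)

Section counting.
Context {T : Type} {R : realType}.
Implicit Types (X : nat -> T -> R) (w : T).

Lemma nonzero_stepsS X j w :
  nonzero_steps X j.+1 w = (nonzero_steps X j w + (X j.+1 w != 0%R))%N.
Proof. by rewrite /nonzero_steps big_nat_recr. Qed.

Lemma nonzero_steps_le X j w : (nonzero_steps X j w <= j)%N.
Proof.
elim: j => [|j IH]; first by rewrite /nonzero_steps big_nil.
by rewrite nonzero_stepsS -addn1 leq_add// leq_b1.
Qed.

Lemma natr_nonzero_steps X j w :
  (nonzero_steps X j w)%:R =
  \sum_(1 <= i < j.+1) \1_[set v | X i v != 0] w :> R.
Proof.
rewrite /nonzero_steps natr_sum; apply: eq_bigr => i _; rewrite indicE.
by congr (_%:R); rewrite (_ : (w \in _) = (X i w != 0))//; apply/asboolP/idP.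
Qed.

End counting.

Lemma measurable_neq0 (d : measure_display) (T : measurableType d)
    (R : realType) (f : T -> R) :
  measurable_fun setT f -> measurable [set w | f w != 0].
Proof.
move=> mf.
have -> : [set v | f v != 0] = setT `&` f @^-1` (~` [set 0]).
  by rewrite setTI; apply/seteqP; split => v /eqP.
by apply: mf => //; exact: measurableC.
Qed.

Lemma measurable_nonzero_steps (d : measure_display) (T : measurableType d)
    (R : realType) (X : nat -> T -> R) (j a : nat) :
  (forall i, (1 <= i <= j)%N -> measurable_fun setT (X i)) ->
  measurable [set w | nonzero_steps X j w = a].
Proof.
move=> mX.
have mN : measurable_fun setT (fun w => (nonzero_steps X j w)%:R : R).
  have -> : (fun w => (nonzero_steps X j w)%:R : R) = (fun w =>
      \sum_(1 <= i < j.+1)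
        (if (1 <= i <= j)%N then \1_[set v | X i v != 0] w else 0)).
    by apply/funext => w; rewrite natr_nonzero_steps big_nat big_mkcond.
  apply: measurable_sum => i; case: (boolP (1 <= i <= j)%N) => [ij|_].
    by apply: measurable_indic; exact/measurable_neq0/mX.
  exact: measurable_cst.
have -> : [set w | nonzero_steps X j w = a] =
    setT `&` (fun w => (nonzero_steps X j w)%:R : R) @^-1` [set a%:R].
  rewrite setTI; apply/seteqP; split => w /=; first by move=> ->.
  by move/eqP; rewrite eqr_nat => /eqP.
by apply: mN => //; exact: measurable_set1.
Qed.

Section past.
Context {d : measure_display} {T : measurableType d} {R : realType}.
Variable X : nat -> {mfun T >-> R}.

(** The space T with [past X k] as its measurable sets: measurability lemmas
    used on this type show that events belong to the past. *)
Definition past_space k :=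
  g_sigma_algebraType
    (\bigcup_(i in [set i | (1 <= i <= k)%N]) sigma_of (X i)).

Lemma past_measurable k A : past X k A -> measurable A.
Proof.
apply: smallest_sub; first exact: sigma_algebra_measurable.
by move=> B [i _ [C mC <-]]; exact: measurable_funPT.
Qed.

Lemma past_step_measurable k i : (1 <= i <= k)%N ->
  measurable_fun setT (X i : past_space k -> R).
Proof.
by move=> ik _ B mB; apply: sub_sigma_algebra; exists i => //; exists B.
Qed.

Lemma past_nonzero_steps k j a : (j <= k)%N ->
  past X k [set w | nonzero_steps X j w = a].
Proof.
move=> jk; have := @measurable_nonzero_steps _ (past_space k) R X j a.
apply => i /andP[i1 ij]; apply: past_step_measurable.
by rewrite i1 (leq_trans ij).
Qed.

Lemma pastI k A B : past X k A -> past X k B -> past X k (A `&` B).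
Proof. exact: (@measurableI _ (past_space k)). Qed.

Lemma past_nonzero k i : (1 <= i <= k)%N -> past X k [set w | X i w != 0].
Proof.
by move=> ik; exact: (measurable_neq0 (past_step_measurable ik)).
Qed.

End past.

(** * Conditional law of one step *)

Section one_step.
Context {d : measure_display} {T : measurableType d} {R : realType}.
Variables (P : probability T R) (X : nat -> {RV P >-> R}).
Local Notation N := (nonzero_steps X).

(** Counts take finitely many values, so a function of two counts is a finite
    combination of indicators of events of the past. *)
Lemma steps_indic_sum (g : nat -> nat -> R) l k w :
  g (N l w) (N k w) = \sum_(ab : 'I_l.+1 * 'I_k.+1)
    g ab.1 ab.2 * \1_([set v | N l v = ab.1] `&` [set v | N k v = ab.2]) w.
Proof.
pose ab : 'I_l.+1 * 'I_k.+1 := (inord (N l w), inord (N k w)).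
have e1 : ab.1 = N l w :> nat by rewrite inordK// ltnS nonzero_steps_le.
have e2 : ab.2 = N k w :> nat by rewrite inordK// ltnS nonzero_steps_le.
rewrite (bigD1 ab)//= big1 ?addr0.
  by rewrite !inordK ?ltnS ?nonzero_steps_le// indicE mem_set// mulr1.
move=> cd cdab; rewrite indicE memNset ?mulr0// => -[/= h1 h2].
move: cdab; rewrite [cd]surjective_pairing /ab => /eqP; apply.
by congr pair; apply/val_inj; rewrite /= inordK ?ltnS ?nonzero_steps_le.
Qed.

Lemma measurable_steps l k a b :
  measurable ([set v | N l v = a] `&` [set v | N k v = b]).
Proof. by apply: measurableI; exact: measurable_nonzero_steps. Qed.

Lemma bounded_rv_steps (g : nat -> nat -> R) l k :
  bounded_rv (fun w => g (N l w) (N k w)).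
Proof.
under eq_fun do rewrite steps_indic_sum.
apply: bounded_rv_sum => ab; apply: bounded_rvZ.
by apply: bounded_rv_indic; exact: measurable_steps.
Qed.

(** The prescribed values of the law of K on {1, ..., l} already sum to 1, so
    K almost surely lies in that range. *)
Lemma uniform_mean_sum l (K : {RV P >-> nat}) :
  (0 < l)%N -> uniform_upto P l K ->
  mean P (fun w => \sum_(1 <= i < l.+1) \1_[set v | K v = i] w) = 1.
Proof.
move=> l0 uK.
have mK i : measurable [set v | K v = i].
  have -> : [set v | K v = i] = K @^-1` [set i] by [].
  exact: measurable_funPTI.
rewrite mean_sum; last by move=> i; exact: bounded_rv_indic.
under eq_big_nat => i il do rewrite mean_indic// uK//=.
rewrite big_const_nat iter_addr_0 subn1/= -[_ *+ _]mulr_natl divff//.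
by rewrite pnatr_eq0 -lt0n.
Qed.

Lemma sum_indic_eq (K : T -> nat) (h : nat -> R) l w :
  \sum_(1 <= i < l.+1) h i * \1_[set v | K v = i] w =
  if (1 <= K w <= l)%N then h (K w) else 0.
Proof.
have indE i : \1_[set v | K v = i] w = (K w == i)%:R :> R.
  by rewrite indicE; congr ((nat_of_bool _)%:R); apply/idP/eqP; rewrite inE.
case: ifPn => [Kl|KNl].
  rewrite (bigD1_seq (K w)) ?mem_index_iota ?ltnS ?iota_uniq//=.
  rewrite big1 ?addr0 => [|i iK].
    by rewrite indE eqxx mulr1.
  by rewrite indE eq_sym (negbTE iK) mulr0.
rewrite big_nat big1// => i; rewrite ltnS => il; rewrite indE.
by case: eqP => [Ki|_]; [move: KNl; rewrite Ki il|rewrite mulr0].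
Qed.

Lemma step_law_neq0 (p q r : R) (E : {RV P >-> R}) : step_law P p q r E ->
  P [set w | E w != 0] = (1 - r)%:E.
Proof.
move=> [_ _ E0].
have -> : [set w | E w != 0] = ~` [set w | E w = 0].
  by apply/seteqP; split => w /= /eqP.
rewrite probability_setC ?E0//.
have -> : [set v | E v = 0] = E @^-1` [set 0] by [].
exact: measurable_funPTI.
Qed.

(** Up to a null set, the event that step k + 1 is non-zero is the disjoint
    union over i in {1, ..., l} of the events K = i, X_i != 0, E != 0. By
    independence the i-th piece, intersected with A, has probability
    P(A, X_i != 0) (1 - r) / l. *)
Lemma mean_nonzero_step (p q r : R) k l (A : set T) : (1 <= l <= k)%N ->
  delayed_step p q r X k l -> past X k A ->
  mean P (fun w => \1_A w * \1_[set v | X k.+1 v != 0] w) =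
  mean P (fun w => \1_A w * ((1 - r) * (N l w)%:R / l%:R)).
Proof.
move=> /andP[l1 lk] [K [E [uK sE ind aeX]]] pA.
have mne (Z : {RV P >-> R}) : measurable [set v | Z v != 0].
  exact: measurable_neq0.
have mK i : measurable [set v | K v = i].
  have -> : [set v | K v = i] = K @^-1` [set i] by [].
  exact: measurable_funPTI.
have mA := past_measurable pA.
set I' : T -> R := \1_[set v | X k.+1 v != 0].
pose kap w : R := \sum_(1 <= i < l.+1) \1_[set v | K v = i] w.
pose F i w : R := \1_A w * \1_[set v | X i v != 0] w * \1_[set v | E v != 0] w.
have bA := bounded_rv_indic (R := R) mA.
have bI (Z : {RV P >-> R}) := bounded_rv_indic (R := R) (mne Z).
have bAI := bounded_rvM bA (bI (X k.+1)).
have bK i := bounded_rv_indic (R := R) (mK i).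
have bkap : bounded_rv kap by apply: bounded_rv_sum => i; exact: bK.
have bF i : bounded_rv (F i).
  exact: (bounded_rvM (bounded_rvM bA (bI (X i))) (bI E)).
have bFK i : bounded_rv (fun w => F i w * \1_[set v | K v = i] w).
  exact: (bounded_rvM (bF i) (bK i)).
have kapE w : kap w = (1 <= K w <= l)%N%:R.
  have := sum_indic_eq K (fun=> 1) l w.
  rewrite /kap; under eq_bigr do rewrite mul1r.
  by move=> ->; case: ifP.
have ind01 (B : set T) w : (0 : R) <= \1_B w <= (1 : R).
  by rewrite indicE ler0n lern1 leq_b1.
(* Inserting kap costs nothing, since 0 <= 1 - kap has mean 0. *)
have -> : mean P (fun w => \1_A w * I' w) =
    mean P (fun w => \1_A w * I' w * kap w).
  apply/eqP; rewrite -subr_eq0 -meanB//; last exact: bounded_rvM.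
  rewrite eq_le; apply/andP; split.
    rewrite -[leRHS](_ : mean P (fun w => 1 - kap w) = 0); last first.
      rewrite meanB//; last exact: bounded_rv_cst.
      by rewrite mean_cst uniform_mean_sum// subrr.
    apply: mean_le => [||w].
    - by apply: bounded_rvB => //; exact: bounded_rvM.
    - by apply: bounded_rvB => //; exact: bounded_rv_cst.
    - rewrite -[X in X - _]mulr1 -mulrBr ler_piMl//.
        by rewrite kapE subr_ge0 lern1 leq_b1.
      have /andP[a0 a1] := ind01 A w.
      have /andP[b0 b1] := ind01 [set v | X k.+1 v != 0] w.
      by rewrite mulr_ile1.
  apply: mean_ge0 => [|w].
    by apply: bounded_rvB => //; exact: bounded_rvM.
  rewrite -[X in X - _]mulr1 -mulrBr mulr_ge0//; last first.
    by rewrite kapE subr_ge0 lern1 leq_b1.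
  have /andP[a0 a1] := ind01 A w.
  by have /andP[b0 b1] := ind01 [set v | X k.+1 v != 0] w; rewrite mulr_ge0.
transitivity (mean P
    (fun w => \sum_(1 <= i < l.+1) F i w * \1_[set v | K v = i] w)).
  apply: mean_ae_eq; first exact: bounded_rvM.
    exact: bounded_rv_sum.
  apply: filterS aeX => w Xw.
  rewrite (sum_indic_eq K (F ^~ w)) kapE.
  case: ifP => _; rewrite ?mulr0// mulr1.
  rewrite /F -mulrA; congr (_ * _); rewrite /I' !indicE -natrM mulnb.
  congr ((nat_of_bool _)%:R).
  apply/idP/andP; rewrite !inE/= Xw mulf_eq0 negb_or.
    by move=> /andP[-> ->].
  by move=> [-> ->].
rewrite mean_sum//.
have bNl i : bounded_rv (R := R) (fun w => \1_A w * \1_[set v | X i v != 0] w).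
  exact: (bounded_rvM bA (bI (X i))).
transitivity (\sum_(1 <= i < l.+1)
    (1 - r) / l%:R * mean P (fun w => \1_A w * \1_[set v | X i v != 0] w)).
  apply: eq_big_nat => i; rewrite ltnS => /andP[i1 il].
  have mAi : measurable (A `&` [set v | X i v != 0]) by exact: measurableI.
  have -> : (fun w => \1_A w * \1_[set v | X i v != 0] w) =
      \1_(A `&` [set v | X i v != 0]) :> (T -> R) by rewrite indicI.
  have -> : (fun w => F i w * \1_[set v | K v = i] w) =
      \1_(A `&` [set v | X i v != 0] `&` [set v | K v = i] `&`
        [set v | E v != 0]) :> (T -> R).
    by rewrite !indicI; apply/funext => w /=; rewrite /F mulrAC.
  rewrite !mean_indic//.
    2: exact: measurableI (measurableI _ _ mAi (mK i)) (mne E).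
  rewrite ind; last 3 first.
  - by apply: pastI => //; apply: past_nonzero; rewrite i1 (leq_trans il).
  - by exists [set i] => //; rewrite setTI.
  - exists (~` [set 0]); first exact: measurableC.
    by rewrite setTI; apply/seteqP; split => v /= /eqP.
  rewrite uK ?i1// (step_law_neq0 sE) !fineM//=; last 2 first.
  - exact: fin_num_measure.
  - by rewrite fin_numM// fin_num_measure.
  by rewrite mulrC [fine _ * _]mulrC mulrA.
rewrite -mulr_sumr -mean_sum// -meanZ; last exact: bounded_rv_sum.
congr mean; apply/funext => w.
by rewrite natr_nonzero_steps -mulr_sumr; ring.
Qed.

(** Conditional probability that a step recalling one of the first l steps is
    non-zero, when a of these are non-zero. *)
Definition move_prob (r : R) l a : R := (1 - r) * a%:R / l%:R.

(** The case l = k describes the full-memory phase and l = m the restricted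
    one; functions of the pair of counts are needed because in the latter the
    transition depends on N_m. *)
Lemma mean_step (p q r : R) k l (g : nat -> nat -> R) : (1 <= l <= k)%N ->
  delayed_step p q r X k l ->
  mean P (fun w => g (N l w) (N k.+1 w)) =
  mean P (fun w => move_prob r l (N l w) * g (N l w) (N k w).+1
     + (1 - move_prob r l (N l w)) * g (N l w) (N k w)).
Proof.
move=> lk dX.
pose h a b := g a b.+1 - g a b.
have mne : measurable [set v | X k.+1 v != 0] by exact: measurable_neq0.
set I' : T -> R := \1_[set v | X k.+1 v != 0].
have bI : bounded_rv I' by exact: bounded_rv_indic.
have bm : bounded_rv (fun w => move_prob r l (N l w)).
  exact: (bounded_rv_steps (fun a _ => move_prob r l a) l l).
have bg : bounded_rv (fun w => g (N l w) (N k w)) by exact: bounded_rv_steps.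
have bh : bounded_rv (fun w => h (N l w) (N k w)) by exact: bounded_rv_steps.
transitivity (mean P (fun w => h (N l w) (N k w) * I' w + g (N l w) (N k w))).
  congr mean; apply/funext => w; rewrite nonzero_stepsS /I' indicE /h.
  case: (boolP (X k.+1 w != 0)) => Xw.
    by rewrite mem_set// addn1 mulr1 subrK.
  by rewrite memNset ?mulr0 ?add0r ?addn0//=; exact/negP.
transitivity (mean P (fun w =>
    h (N l w) (N k w) * move_prob r l (N l w) + g (N l w) (N k w))); last first.
  by congr mean; apply/funext => w; rewrite /h; ring.
rewrite !meanD//; [|exact: bounded_rvM..]; congr (_ + _).
pose A (ab : 'I_l.+1 * 'I_k.+1) :=
  [set v | N l v = ab.1] `&` [set v | N k v = ab.2].
have decomp (J : T -> R) : bounded_rv J ->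
    mean P (fun w => h (N l w) (N k w) * J w) =
    \sum_(ab : 'I_l.+1 * 'I_k.+1)
      h ab.1 ab.2 * mean P (fun w => \1_(A ab) w * J w).
  move=> bJ.
  have bAJ ab : bounded_rv (fun w => \1_(A ab) w * J w).
    apply: bounded_rvM => //; apply: bounded_rv_indic.
    exact: measurable_steps.
  transitivity (mean P (fun w => \sum_(ab : 'I_l.+1 * 'I_k.+1)
      h ab.1 ab.2 * (\1_(A ab) w * J w))).
    congr mean; apply/funext => w; rewrite (steps_indic_sum h) mulr_suml.
    by apply: eq_bigr => ab _; rewrite mulrA.
  rewrite mean_sum; last by move=> ab; exact: bounded_rvZ.
  by apply: eq_bigr => ab _; rewrite meanZ.
rewrite !decomp//; apply: eq_bigr => ab _; congr (_ * _).
apply: mean_nonzero_step dX _ => //.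
by case/andP: lk => _ lk; apply: pastI; exact: past_nonzero_steps.
Qed.

Lemma mean_first_step (p q r : R) (g : nat -> R) : step_law P p q r (X 1%N) ->
  mean P (fun w => g (N 1 w)) = (1 - r) * g 1%N + r * g 0%N.
Proof.
move=> sX.
have mne : measurable [set v | X 1%N v != 0] by exact: measurable_neq0.
transitivity (mean P
    (fun w => (g 1%N - g 0%N) * \1_[set v | X 1%N v != 0] w + g 0%N)).
  congr mean; apply/funext => w.
  rewrite nonzero_stepsS {1}/nonzero_steps big_nil add0n indicE.
  case: (boolP (X 1%N w != 0)) => Xw.
    by rewrite mem_set// mulr1 subrK.
  by rewrite memNset ?mulr0 ?add0r//=; exact/negP.
have b1 := bounded_rv_indic (R := R) mne.
rewrite meanD; [|exact: bounded_rvZ|exact: bounded_rv_cst].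
by rewrite meanZ// mean_cst mean_indic// (step_law_neq0 sX)/=; ring.
Qed.

End one_step.

(** * Law and moments of the counts *)

(** [mean_step] expresses the mean of g at time k + 1 as the mean of another
    function at time k; the induction therefore runs over all g at once. *)
Lemma full_memory_law_unique (R : realType) (p q r : R)
    (d : measure_display) (T : measurableType d) (P : probability T R)
    (X : nat -> {RV P >-> R})
    (d' : measure_display) (T' : measurableType d') (P' : probability T' R)
    (X' : nat -> {RV P' >-> R}) (m : nat) :
  step_law P p q r (X 1%N) -> step_law P' p q r (X' 1%N) ->
  (forall k, (1 <= k < m)%N -> delayed_step p q r X k k) ->
  (forall k, (1 <= k < m)%N -> delayed_step p q r X' k k) ->
  forall k, (1 <= k <= m)%N -> forall g : nat -> R,
    mean P (fun w => g (nonzero_steps X k w)) =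
    mean P' (fun w => g (nonzero_steps X' k w)).
Proof.
move=> s1 s1' sX sX'; elim=> // k IH /andP[_ km] g.
case: k => [|k] in IH km *.
  by rewrite (mean_first_step _ s1) (mean_first_step _ s1').
have kk : (1 <= k.+1 <= k.+1)%N by rewrite leqnn.
rewrite (mean_step (fun _ b => g b) kk (sX _ _))//.
rewrite (mean_step (fun _ b => g b) kk (sX' _ _))//.
have km' : (0 < k.+1 <= m)%N by exact: ltnW.
exact: (IH km' (fun b =>
  move_prob r k.+1 b * g b.+1 + (1 - move_prob r k.+1 b) * g b)).
Qed.

Section moments.
Context {d : measure_display} {T : measurableType d} {R : realType}.
Variables (P : probability T R) (X : nat -> {RV P >-> R}) (p q r : R).
Hypothesis r01 : 0 <= r <= 1.
Local Notation N := (nonzero_steps X).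

Lemma move_prob_ge0 l a : 0 <= move_prob r l a.
Proof.
by case/andP: r01 => r0 r1; rewrite /move_prob !mulr_ge0 ?invr_ge0// subr_ge0.
Qed.

(** The denominator is k + 2 rather than k + 1: for 0 < a < 1 the ratio
    ((k + 2) / (k + 1))^a is smaller than 1 + a / (k + 1). *)
Lemma powR_succ_ratio (a : R) k : 0 <= a ->
  (k.+1%:R `^ a) * (1 + a / k.+2%:R) <= (k.+2%:R : R) `^ a.
Proof.
move=> a0; have k1 : 0 < (k.+1%:R : R) by [].
have k2 : 0 < (k.+2%:R : R) by [].
have h : 1 + a / k.+2%:R <= expR (a * (ln k.+2%:R - ln k.+1%:R)).
  apply: le_trans (expR_ge1Dx _) _; rewrite ler_expR ler_wpM2l//.
  have : ln (1 + (- k.+2%:R^-1)) <= - k.+2%:R^-1 :> R.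
    by apply: le_ln1Dx; rewrite ltrN2 invf_lt1// ltr1n.
  have -> : 1 + (- k.+2%:R^-1) = k.+1%:R / k.+2%:R :> R.
    have -> : k.+1%:R = k.+2%:R - 1 :> R by rewrite -[in RHS]natr1 addrK.
    by rewrite mulrBl divff ?gt_eqF// mul1r.
  by rewrite ln_div ?posrE// -[in X in _ -> X]lerN2 opprB.
apply: (le_trans (ler_wpM2l (powR_ge0 _ _) h)).
rewrite /powR !gt_eqF// -expRD ler_expR; lra.
Qed.

(** Each of the N_k non-zero steps is recalled and kept non-zero with
    probability (1 - r) / k, so step k + 1 multiplies the mean by
    1 + (1 - r) / k; the product of these factors grows like k^(1-r). *)
Lemma mean_nonzero_steps_le m : step_law P p q r (X 1%N) ->
  (forall k, (1 <= k < m)%N -> delayed_step p q r X k k) ->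
  forall k, (1 <= k <= m)%N ->
  mean P (fun w => (N k w)%:R) <= 2 * k%:R `^ (1 - r).
Proof.
case/andP: (r01) => r0 r1 s1 sX.
have rec k : (1 <= k < m)%N -> mean P (fun w => (N k.+1 w)%:R) =
    mean P (fun w => (N k w)%:R) * (1 + (1 - r) / k%:R).
  move=> km; have kk : (1 <= k <= k)%N by case/andP: km => ->; rewrite leqnn.
  rewrite (mean_step (fun _ b => b%:R) kk (sX _ km)) mulrC -meanZ; last first.
    exact: (bounded_rv_steps _ (fun _ b => b%:R) k k).
  congr mean; apply/funext => w; rewrite /move_prob -natr1; ring.
have one : mean P (fun w => (N 1 w)%:R) <= 1.
  by rewrite (mean_first_step (fun b => b%:R) s1) mulr1 mulr0 addr0; lra.
(* The time lag of one matches the shift in powR_succ_ratio; the constant 2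
   absorbs the first factor 1 + (1 - r). *)
have two k : (k.+2 <= m)%N ->
    mean P (fun w => (N k.+2 w)%:R) <= 2 * k.+1%:R `^ (1 - r).
  elim: k => [|k IH] km; rewrite rec// ?ltnW//.
    rewrite powR1 mulr1 divr1 mulrC.
    have := mean_ge0 P (bounded_rv_steps X (fun _ b => b%:R : R) 1 1)
      (fun w => ler0n R _).
    move: one; set u := mean _ _ => u1 u0.
    by rewrite mulrDl mul1r; nra.
  have r1' : 0 <= 1 - r by lra.
  apply: le_trans _ (ler_wpM2l _ (powR_succ_ratio k r1')) => //.
  rewrite mulrA ler_wpM2r//; last exact/IH/ltnW.
  by rewrite addr_ge0// divr_ge0.
case=> [|[|k]]// /andP[_ km].
  by rewrite powR1 mulr1 (le_trans one)// ler1n.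
apply: (le_trans (two _ km)); rewrite ler_wpM2l//.
by apply: ge0_ler_powR; rewrite ?nnegrE// ?ler_nat//; lra.
Qed.

(** The increments are centred given the past, with conditional variance
    rho (1 - rho) <= rho, and orthogonal increments add their variances. *)
Lemma mean_deviation_sq m n : (1 <= m)%N ->
  (forall k, (m <= k < n)%N -> delayed_step p q r X k m) ->
  forall j, (m + j <= n)%N ->
  mean P (fun w =>
    ((N (m + j) w)%:R - (N m w)%:R - j%:R * move_prob r m (N m w)) ^+ 2)
   <= j%:R * mean P (fun w => move_prob r m (N m w)).
Proof.
move=> m1 sX; elim=> [|j IH jn].
  rewrite addn0 !mul0r -(mean_cst P 0) => _.
  by under eq_fun do rewrite subrr mul0r subrr expr0n.
have mj : (m <= m + j < n)%N by rewrite leq_addr/= -addnS.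
pose g (j a b : nat) : R := (b%:R - a%:R - j%:R * move_prob r m a) ^+ 2.
rewrite addnS (mean_step (g j.+1) _ (sX _ mj)); last by rewrite m1 leq_addr.
have bmp := bounded_rv_steps X (fun a _ => move_prob r m a) m m.
have bg := bounded_rv_steps X (g j) m (m + j).
apply: (@le_trans _ _ (mean P
    (fun w => g j (N m w) (N (m + j) w) + move_prob r m (N m w)))).
  apply: mean_le => [||w].
  - exact: (bounded_rv_steps X (fun a b =>
      move_prob r m a * g j.+1 a b.+1 + (1 - move_prob r m a) * g j.+1 a b)).
  - exact: bounded_rvD.
  - have := move_prob_ge0 m (N m w).
    rewrite /g -!natr1; move: (move_prob _ _ _) => x x0; nra.
rewrite meanD// -natr1 mulrDl mul1r lerD2r; apply: IH.
by rewrite -ltnS -addnS leqW.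
Qed.

End moments.

(** * Comparison with the full-memory phase *)

Section slutsky.
Context {R : realType}.
Implicit Types (f : R -> R).

(** Uniform continuity, but with only one of the two points confined to the
    interval. *)
Lemma continuous_modulus_on_itv f (a b e : R) : continuous f -> 0 < e ->
  exists2 delta : R, 0 < delta &
    forall x z, a <= x <= b -> `|z - x| < delta -> `|f z - f x| <= e.
Proof.
move=> cf e0.
have /compact_near_coveringP cov := @segment_compact R a b.
have := cov R 0^'+
  (fun delta x => forall z, `|z - x| < delta -> `|f z - f x| <= e) _ _.
case=> [x _|]; last first.
  move=> eta /= eta0 H; exists (eta / 2); first by rewrite divr_gt0.
  move=> x z xab; apply: (H (eta / 2)) => /=; last by rewrite in_itv.
    rewrite sub0r normrN ger0_norm ?divr_ge0 ?ltW//.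
    by rewrite ltr_pdivrMr// ltr_pMr// ltr1n.
  by rewrite divr_gt0.
have /cvgrPdist_le/(_ (e / 2)) := cf x.
rewrite divr_gt0// => /(_ isT)[eta /= eta0 H].
exists (ball x (eta / 2), [set t : R | t < eta / 2]).
  split => /=; first by exists (eta / 2) => //=; rewrite divr_gt0.
  by apply: nbhs_right_lt; rewrite divr_gt0.
move=> [y t] /= [xy te] z zy.
have fy : `|f x - f y| <= e / 2.
  apply: H => /=; apply: (lt_le_trans xy).
  by rewrite ler_pdivrMr// ler_pMr// ler1n.
have fz : `|f x - f z| <= e / 2.
  apply: H => /=; rewrite [eta]splitr -(subrKA y).
  apply: (le_lt_trans (ler_normD _ _)); rewrite ltrD//.
  by rewrite distrC (lt_trans zy).
rewrite -(subrKA (f x)) [e]splitr (le_trans (ler_normD _ _))// lerD//.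
by rewrite distrC.
Qed.

(** A deterministic form of Slutsky's lemma: taking means bounds the effect of
    the perturbation u + v by the mean of w, the second moment of u and the
    first absolute moment of v. If the difference exceeds e then w >= M,
    |u| >= delta / 2 or |v| >= delta / 2; the sum multiplying 2 B is then at
    least 1, and 2 B bounds any difference of values of f. *)
Lemma bounded_continuous_perturbation f (B e M : R) : continuous f ->
  (forall x, `|f x| <= B) -> 0 < e -> 0 < M ->
  exists2 delta : R, 0 < delta & forall w u v, 0 <= w ->
    `|f (w + u + v) - f w| <=
      e + 2 * B * (w / M + 4 / delta ^+ 2 * u ^+ 2 + 2 / delta * `|v|).
Proof.
move=> cf fB e0 M0; have [delta d0 H] := continuous_modulus_on_itv 0 M cf e0.
exists delta => // w u v w0.
have B0 : 0 <= B by apply: le_trans (fB 0).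
have u0 : 0 <= 4 / delta ^+ 2 * u ^+ 2.
  by rewrite mulr_ge0 ?sqr_ge0// divr_ge0// sqr_ge0.
have v0 : 0 <= 2 / delta * `|v| by rewrite mulr_ge0// divr_ge0// ltW.
have wM : 0 <= w / M by rewrite divr_ge0// ltW.
have far : 1 <= w / M + 4 / delta ^+ 2 * u ^+ 2 + 2 / delta * `|v| ->
    `|f (w + u + v) - f w| <=
      e + 2 * B * (w / M + 4 / delta ^+ 2 * u ^+ 2 + 2 / delta * `|v|).
  move=> h; apply: (@le_trans _ _ (2 * B)).
    rewrite mulr_natl mulr2n; apply: (le_trans (ler_normB _ _)).
    by rewrite lerD.
  rewrite -[leLHS]mulr1; apply: ler_wpDl; first exact: ltW.
  by rewrite ler_wpM2l// mulr_ge0.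
have [wltM|Mw] := ltP w M; last first.
  apply: far; have : 1 <= w / M by rewrite ler_pdivlMr// mul1r.
  by lra.
have [ud|du] := ltP `|u| (delta / 2); last first.
  apply: far; suff : 1 <= 4 / delta ^+ 2 * u ^+ 2 by lra.
  rewrite mulrAC ler_pdivlMr ?exprn_gt0// mul1r -(real_normK (num_real u)).
  have d2 : 0 <= delta / 2 by rewrite divr_ge0// ltW.
  have := ler_pM d2 d2 du du; rewrite -!expr2 exprMn exprVn; lra.
have [vd|dv] := ltP `|v| (delta / 2); last first.
  apply: far; suff : 1 <= 2 / delta * `|v| by lra.
  by rewrite mulrAC ler_pdivlMr// mul1r mulrC; lra.
apply: (@le_trans _ _ e); last first.
  by rewrite lerDl mulr_ge0// ?mulr_ge0// !addr_ge0.
apply: H; first by rewrite w0 ltW.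
have -> : w + u + v - w = u + v by ring.
rewrite [delta]splitr.
by apply: (le_lt_trans (ler_normD _ _)); rewrite ltrD.
Qed.

End slutsky.

Section restricted.
Context {R : realType} {d : measure_display} {T : measurableType d}.
Variables (P : probability T R) (X : nat -> {RV P >-> R}) (p q r : R).
Hypothesis r01 : 0 < r < 1.
Local Notation N := (nonzero_steps X).

(** The remainder splits as U + V, where U is centred and small in mean square,
    and V, equal to (m^r / n) (N_m - m rho), is the error made on the first m
    steps. The bound N_m^2 <= m N_m would lose too much in mean square, so V is
    controlled in mean. *)
Lemma restricted_memory_close (f : R -> R) (B e M delta : R) (m n : nat) :
  (forall x, `|f x| <= B) -> 0 < M -> 0 < delta ->
  (forall w u v, 0 <= w -> `|f (w + u + v) - f w| <=
      e + 2 * B * (w / M + 4 / delta ^+ 2 * u ^+ 2 + 2 / delta * `|v|)) ->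
  (1 <= m <= n)%N -> restricted_memory_derw p q r m n X ->
  `|mean P (fun w => f ((N n w)%:R * m%:R `^ r / n%:R)) -
    mean P (fun w => f ((1 - r) * (N m w)%:R / m%:R `^ (1 - r)))|
  <= e + 2 * B * (2 / M + (8 / delta ^+ 2 + 4 / delta) * (m%:R / n%:R)).
Proof.
move=> fB M0 d0 H /andP[m1 mn] [s1 sfull srest].
have r01' : 0 <= r <= 1 by case/andP: r01 => *; apply/andP; split; exact: ltW.
have B0 : 0 <= B by apply: le_trans (fB 0).
have /andP[r0 r1] := r01'.
have mR : 0 < (m%:R : R) by rewrite ltr0n.
have nR : 0 < (n%:R : R) by rewrite ltr0n (leq_trans m1).
pose a : R := m%:R `^ r; pose b : R := m%:R `^ (1 - r).
have a0 : 0 < a by rewrite powR_gt0.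
have b0 : 0 < b by rewrite powR_gt0.
have ab : a * b = m%:R.
  by rewrite -powRD ?subrKC ?powRr1// ?gt_eqF// implybT.
have am : a <= m%:R.
  by rewrite -[leRHS]powRr1//; apply: ler_powR; rewrite ?ler1n.
pose W (i : nat) : R := (1 - r) * i%:R / b.
pose U (i j : nat) : R :=
  a / n%:R * (j%:R - i%:R - (n - m)%:R * move_prob r m i).
pose V (i : nat) : R := a / n%:R * (r * i%:R).
have ZE i j : j%:R * a / n%:R = W i + U i j + V i.
  rewrite /W /U /V natrB// /move_prob -ab; field.
  by rewrite !gt_eqF.
have u2 : mean P (fun w => (N m w)%:R) <= 2 * b.
  by apply: (mean_nonzero_steps_le r01' s1 sfull); rewrite m1/=.
have bN := bounded_rv_steps X (fun i _ => i%:R : R) m m.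
set u := mean P _ in u2.
have u0 : 0 <= u by exact: mean_ge0.
have mW : mean P (fun w => W (N m w)) <= 2.
  have -> : (fun w => W (N m w)) = (fun w => (1 - r) / b * (N m w)%:R).
    by apply/funext => w; rewrite /W mulrAC.
  rewrite meanZ// -/u mulrAC ler_pdivrMr//.
  apply: le_trans u2; rewrite -[leRHS]mul1r ler_wpM2r//; lra.
have mV : mean P (fun w => `|V (N m w)|) <= 2 * (m%:R / n%:R).
  have -> : (fun w => `|V (N m w)|) =
      (fun w => (a / n%:R * r) * (N m w)%:R).
    apply/funext => w; rewrite /V mulrA ger0_norm//.
    by rewrite !mulr_ge0 ?invr_ge0// ltW.
  rewrite meanZ// -/u -ab.
  have h : a / n%:R * r * u <= a / n%:R * 1 * (2 * b).
    have an : 0 <= a / n%:R by rewrite divr_ge0 ?ltW.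
    by apply: ler_pM => //; [exact: mulr_ge0|exact: ler_wpM2l].
  by apply: (le_trans h); lra.
have mU : mean P (fun w => U (N m w) (N n w) ^+ 2) <= 2 * (m%:R / n%:R).
  pose S w : R := (N n w)%:R - (N m w)%:R
     - (n - m)%:R * move_prob r m (N m w).
  have -> : (fun w => U (N m w) (N n w) ^+ 2) =
      (fun w => (a / n%:R) ^+ 2 * S w ^+ 2).
    by apply/funext => w; rewrite /U exprMn.
  rewrite meanZ; last first.
    exact: (bounded_rv_steps X
      (fun i j => (j%:R - i%:R - (n - m)%:R * move_prob r m i) ^+ 2)).
  have := mean_deviation_sq r01' m1 srest (_ : (m + (n - m) <= n)%N).
  rewrite subnKC// => /(_ (leqnn _)); rewrite -/S => hS.
  have mr : mean P (fun w => move_prob r m (N m w)) <= 2 / a.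
    have -> : (fun w => move_prob r m (N m w)) =
        (fun w => (1 - r) / m%:R * (N m w)%:R).
      by apply/funext => w; rewrite /move_prob mulrAC.
    rewrite meanZ// -/u -ab.
    have h : (1 - r) / (a * b) * u <= 1 / (a * b) * (2 * b).
      apply: ler_pM => //.
        by apply: divr_ge0; [lra|rewrite ltW// mulr_gt0].
      by rewrite ler_pM2r ?invr_gt0 ?mulr_gt0//; lra.
    apply: (le_trans h); rewrite le_eqVlt; apply/orP; left; apply/eqP.
    by field; rewrite !gt_eqF.
  have mr0 : 0 <= mean P (fun w => move_prob r m (N m w)).
    apply: mean_ge0 => [|w]; last exact: move_prob_ge0.
    exact: (bounded_rv_steps X (fun i _ => move_prob r m i) m m).
  have h : (n - m)%:R * mean P (fun w => move_prob r m (N m w)) <=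
      n%:R * (2 / a).
    by apply: ler_pM => //; rewrite ler_nat leq_subr.
  apply: (@le_trans _ _ ((a / n%:R) ^+ 2 * (n%:R * (2 / a)))).
    by rewrite ler_wpM2l ?sqr_ge0// (le_trans hS).
  have -> : (a / n%:R) ^+ 2 * (n%:R * (2 / a)) = 2 * (a / n%:R).
    by field; rewrite !gt_eqF.
  by rewrite ler_wpM2l// ler_pM2r ?invr_gt0.
have bG (g : nat -> nat -> R) : bounded_rv (fun w => g (N m w) (N n w)).
  exact: bounded_rv_steps.
pose Q i j :=
  M^-1 * W i + 4 / delta ^+ 2 * U i j ^+ 2 + 2 / delta * `|V i|.
rewrite -meanB.
  2: exact: (bG (fun _ j => f (j%:R * a / n%:R))).
  2: exact: (bG (fun i _ => f (W i))).
have bf := bG (fun i j => f (j%:R * a / n%:R) - f (W i)).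
apply: (le_trans (norm_mean_le P bf)).
apply: (@le_trans _ _ (mean P (fun w => e + 2 * B * Q (N m w) (N n w)))).
  apply: mean_le => [||w].
  - exact: (bG (fun i j => `|f (j%:R * a / n%:R) - f (W i)|)).
  - exact: (bG (fun i j => e + 2 * B * Q i j)).
  - rewrite (ZE (N m w)) /Q [M^-1 * _]mulrC; apply: H.
    by apply: divr_ge0; [apply: mulr_ge0 => //; lra|exact: ltW].
have bW := bG (fun i _ => W i).
have bU := bG (fun i j => U i j ^+ 2).
have bV := bG (fun i _ => `|V i|).
have bWU := bounded_rvD (bounded_rvZ M^-1 bW) (bounded_rvZ (4 / delta ^+ 2) bU).
have bQ := bG Q.
rewrite meanD; [|exact: bounded_rv_cst|exact: bounded_rvZ].
rewrite mean_cst lerD2l meanZ// ler_wpM2l ?mulr_ge0//.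
rewrite meanD//; last exact: bounded_rvZ.
rewrite meanD; [|exact: bounded_rvZ|exact: bounded_rvZ].
rewrite !meanZ//.
have h1 := ler_wpM2l (ltW (_ : 0 < M^-1)) mW.
have h2 := ler_wpM2l (_ : 0 <= 4 / delta ^+ 2) mU.
have h3 := ler_wpM2l (_ : 0 <= 2 / delta) mV.
apply: (le_trans (lerD (lerD (h1 _) (h2 _)) (h3 _))).
- by rewrite invr_gt0.
- by rewrite divr_ge0// sqr_ge0.
- by rewrite divr_ge0// ltW.
- by rewrite le_eqVlt; apply/orP; left; apply/eqP; field; rewrite !gt_eqF.
Qed.

End restricted.

(** * Convergence in distribution *)

Lemma full_memory_cvg (R : realType) (r : R) (r01 : 0 < r < 1)
    (d : measure_display) (T : measurableType d) (P : probability T R)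
    (X : nat -> {RV P >-> R}) (Y : {RV P >-> R}) (f : R -> R) (B : R) :
  {ae P, forall w, Gamma (2 - r) * (nonzero_steps X j w)%:R / (j%:R `^ (1 - r))
     @[j --> \oo] --> Y w} ->
  continuous f -> (forall x, `|f x| <= B) ->
  mean P (fun w => f ((1 - r) * (nonzero_steps X j w)%:R / j%:R `^ (1 - r)))
    @[j --> \oo] --> mean P (fun w => f (Y w / Gamma (1 - r))).
Proof.
move=> hY cf fB.
have [GE G0] : Gamma (2 - r) = (1 - r) * Gamma (1 - r) /\ 0 < Gamma (1 - r).
  have h : 0 < 1 - r < 1 by case/andP: r01 => *; apply/andP; split; lra.
  by have := Gamma_rec h; rewrite (_ : 1 - r + 1 = 2 - r)//; ring.
pose h (j : nat) (w : T) :=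
  f ((1 - r) * (nonzero_steps X j w)%:R / j%:R `^ (1 - r)).
have bh j : bounded_rv (h j).
  exact: (bounded_rv_steps X
    (fun _ b => f ((1 - r) * b%:R / j%:R `^ (1 - r))) j j).
have bY : bounded_rv (fun w => f (Y w / Gamma (1 - r))).
  split; last by exists B.
  apply: measurableT_comp; first exact: continuous_measurable_fun.
  exact: measurable_funM.
have := @dominated_convergence _ T R P setT measurableT (fun j => EFin \o h j)
  (EFin \o (fun w => f (Y w / Gamma (1 - r)))) (cst B%:E).
case.
- by move=> j; apply/measurable_EFinP; case: (bh j).
- by apply/measurable_EFinP; case: bY.
- apply: filterS hY => w hw _; apply: cvg_EFin; first exact: nearW.
  apply: continuous_cvg; first exact: cf.
  have -> : (fun j => (1 - r) * (nonzero_steps X j w)%:R / j%:R `^ (1 - r)) =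
      (fun j => Gamma (2 - r) * (nonzero_steps X j w)%:R / j%:R `^ (1 - r) *
                (Gamma (1 - r))^-1).
    apply/funext => j; rewrite GE; set z := (_%:R `^ _)^-1.
    by field; rewrite gt_eqF.
  exact: cvgMr_tmp.
- exact: finite_measure_integrable_cst.
- by apply: aeW => w j _; rewrite /= lee_fin; exact: fB.
move=> _ _ H; apply: fine_cvg.
rewrite /mean /Rintegral fineK.
  exact: H.
exact: (integrable_fin_num measurableT (bounded_rv_integrable P bY)).
Qed.

Theorem theorem4p2 (R : realType) (p q r : R)
    (hp : 0 < p < 1) (hq : 0 <= q <= 1) (hr : 0 < r < 1) (hpqr : p + q + r = 1)
    (m : nat -> nat)
    (hm : forall n : nat, (1 <= n)%N -> (1 <= m n <= n)%N)
    (hm_oo : m n @[n --> \oo] --> \oo)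
    (hm_n : (m n)%:R / n%:R @[n --> \oo] --> (0 : R))
    (* the triangular scheme *)
    (d : nat -> measure_display) (Omega : forall n : nat, measurableType (d n))
    (P : forall n : nat, probability (Omega n) R)
    (X : forall n : nat, nat -> {RV (P n) >-> R})
    (hX : forall n : nat, (1 <= n)%N ->
       restricted_memory_derw p q r (m n) n (X n))
    (* the full-memory walk and the almost sure limit Y *)
    (d' : measure_display) (Omega' : measurableType d')
    (P' : probability Omega' R)
    (X' : nat -> {RV P' >-> R})
    (hX' : full_memory_derw p q r X')
    (Y : {RV P' >-> R})
    (hY : {ae P', forall w,
       Gamma (2 - r) * (nonzero_steps X' j w)%:R / (j%:R `^ (1 - r))
         @[j --> \oo] --> Y w}) :
  cvg_in_distribution P
    (fun (n : nat) (w : Omega n) =>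
       (nonzero_steps (X n) n w)%:R * (m n)%:R `^ r / n%:R)
    P' (fun w : Omega' => Y w / Gamma (1 - r)).
Proof.
move=> f cf [B fB].
have bZ n : bounded_rv (f \o (fun w : Omega n =>
    (nonzero_steps (X n) n w)%:R * (m n)%:R `^ r / n%:R)).
  exact: (bounded_rv_steps (X n)
    (fun _ b => f (b%:R * (m n)%:R `^ r / n%:R)) n n).
have bY : bounded_rv (f \o (fun w => Y w / Gamma (1 - r))).
  split; last by exists B => w; exact: fB.
  apply: measurableT_comp; first exact: continuous_measurable_fun.
  exact: measurable_funM.
rewrite (expectation_mean P' bY).
under eq_fun do rewrite (expectation_mean _ (bZ _)).
apply: cvg_EFin; first exact: nearW.
pose c j := mean P' (fun w =>
  f ((1 - r) * (nonzero_steps X' j w)%:R / j%:R `^ (1 - r))).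
have cvc : c (m n) @[n --> \oo] -->
    mean P' (fun w => f (Y w / Gamma (1 - r))).
  apply: (cvg_comp _ _ hm_oo); exact: (full_memory_cvg hr hY cf fB).
(* The first m n steps of the scheme have the law of the full-memory walk. *)
have cE n : (1 <= n)%N -> c (m n) = mean (P n) (fun w =>
    f ((1 - r) * (nonzero_steps (X n) (m n) w)%:R / (m n)%:R `^ (1 - r))).
  move=> n1; have [s1 sX _] := hX n n1; have [s1' sX'] := hX'.
  have h k : (1 <= k < m n)%N -> delayed_step p q r X' k k.
    by case/andP => k1 _; exact: sX'.
  have mn : (1 <= m n <= m n)%N by case/andP: (hm n n1) => ->; rewrite leqnn.
  by rewrite (full_memory_law_unique s1 s1' sX h mn
    (fun b => f ((1 - r) * b%:R / (m n)%:R `^ (1 - r)))).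
have B0 : 0 <= B by apply: le_trans (fB 0).
apply/cvgrPdist_le => e e0.
have e4 : 0 < e / 4 by rewrite divr_gt0.
(* M makes 2 * B * (2 / M) <= e / 4; B + 1 avoids a division by 0. *)
pose M := 16 * (B + 1) / e.
have M0 : 0 < M by rewrite divr_gt0// mulr_gt0//; lra.
have [delta d0 H] := bounded_continuous_perturbation cf fB e4 M0.
pose K := 2 * B * (8 / delta ^+ 2 + 4 / delta).
have small : \forall n \near \oo, K * ((m n)%:R / n%:R) <= e / 4.
  have : K * ((m n)%:R / n%:R) @[n --> \oo] --> K * 0 by exact: cvgMl_tmp.
  rewrite mulr0 => /cvgrPdist_le/(_ _ e4); apply: filterS => n.
  by rewrite sub0r normrN; apply: le_trans; rewrite ler_norm.
have far : 2 * B * (2 / M) <= e / 4.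
  have -> : 2 * B * (2 / M) = B / (B + 1) * (e / 4).
    by rewrite /M; field; rewrite !gt_eqF//; lra.
  by apply: ler_piMl; [exact: ltW|rewrite ler_pdivrMr; lra].
move/cvgrPdist_le/(_ _ e4): cvc => cvc.
near=> n.
have n1 : (1 <= n)%N by near: n; exact: nbhs_infty_ge.
have := restricted_memory_close hr fB M0 d0 H (hm n n1) (hX n n1).
rewrite -cE// => close.
have near1 :
  `|mean P' (fun w => f (Y w / Gamma (1 - r))) - c (m n)| <= e / 4 by near: n.
have near2 : K * ((m n)%:R / n%:R) <= e / 4 by near: n.
have := ler_distD (c (m n)) (mean P' (fun w => f (Y w / Gamma (1 - r))))
  (mean (P n) (fun w =>
    f ((nonzero_steps (X n) n w)%:R * (m n)%:R `^ r / n%:R))).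
rewrite [X in _ <= _ + X -> _]distrC => tri; apply: (le_trans tri).
have {}close := le_trans close (_ : _ <= e / 4 + (e / 4 + e / 4)).
apply: (le_trans (lerD near1 (close _))); last lra.
have KE : 2 * B * ((8 / delta ^+ 2 + 4 / delta) * ((m n)%:R / n%:R)) =
  K * ((m n)%:R / n%:R) by rewrite /K -[RHS]mulrA.
by rewrite lerD2l mulrDr KE lerD.
Unshelve. all: by end_near. Qed.
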